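(* Let $X=(X_U,X_Z)\in\mathcal{H}_{(U,Z)}$ and $Y=(Y_U,Y_Z)\in\mathcal{H}_{(U,Z)}$ be two (smooth) tangent vector fields on the manifold $\mathscr{M}$ of $l\times m$ real matrices of rank $r$. The covariant derivative $\nabla_X Y$ on $\mathscr{M}$ is given, at $R=UZ^T$ and in the coordinates of the horizontal space $\mathcal{H}_{(U,Z)}$, by $$\nabla_X Y=\left(\mathrm{D}_X Y_U+UX_U^TY_U+(X_UY_Z^T+Y_UX_Z^T)Z(Z^TZ)^{-1},\ \mathrm{D}_XY_Z-ZY_U^TX_U\right).$$ Therefore, the geodesic equations on $\mathscr{M}$, for curves $R(t)=U(t)Z(t)^T$ with $(\dot U,\dot Z)\in\mathcal{H}_{(U,Z)}$, are $$\left\{\begin{array}{rl}\ddot{U}+U\dot{U}^T\dot{U}+2\dot{U}\dot{Z}^TZ(Z^TZ)^{-1}= & 0\\ \ddot{Z}-Z\dot{U}^T\dot{U}= & 0.\end{array}\right.$$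
   Context: $\mathcal{M}_{l,m}$ is the space of $l\times m$ real matrices with the Frobenius inner product $\langle A,B\rangle=\mathrm{Tr}(A^TB)$. $\mathscr{M}=\{R\in\mathcal{M}_{l,m} : \mathrm{rank}(R)=r\}$ is the fixed rank manifold, an embedded submanifold. Every $R\in\mathscr{M}$ is written $R=UZ^T$ with $U\in\mathcal{M}_{l,r}$, $U^TU=I$, and $Z\in\mathcal{M}_{m,r}$ of rank $r$ (unique up to $(U,Z)\mapsto(UP,ZP)$, $P$ orthogonal). Each tangent vector $X$ in the tangent space $\mathcal{T}(R)$ is uniquely written $X=X_UZ^T+UX_Z^T$ with $(X_U,X_Z)$ in the horizontal space $\mathcal{H}_{(U,Z)}=\{(X_U,X_Z)\in\mathcal{M}_{l,r}\times\mathcal{M}_{m,r} : U^TX_U=0\}$; one then writes $X=(X_U,X_Z)$. The metric on $\mathscr{M}$ is the one inherited from $\mathcal{M}_{l,m}$: $g((X_U,X_Z),(Y_U,Y_Z))=\mathrm{Tr}(Z^TZX_U^TY_U+X_Z^TY_Z)$. The covariant derivative is $\nabla_XY=\Pi_{\mathcal{T}(R)}(\mathrm{D}_XY)$, where $\Pi_{\mathcal{T}(R)}$ is the orthogonal projection of $\mathcal{M}_{l,m}$ onto $\mathcal{T}(R)$ and $\mathrm{D}_X$ is the usual directional derivative, i.e. the derivative at $t=0$ along a curve $R(t)=U(t)Z(t)^T$ on $\mathscr{M}$ with $R(0)=R$, $\dot R(0)=X$; $\mathrm{D}_XY_U$ and $\mathrm{D}_XY_Z$ are the derivatives of the components $Y_U,Y_Z$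 along a curve $(U(t),Z(t))$ with $(\dot U(0),\dot Z(0))=(X_U,X_Z)$. Geodesics are the curves $R(t)$ on $\mathscr{M}$ with $\nabla_{\dot R}\dot R=0$. *)

(* Defs.v *)
From mathcomp Require Import all_boot all_order all_algebra.
From mathcomp Require Import all_classical all_reals all_analysis.
Set Implicit Arguments.
Unset Strict Implicit.
Unset Printing Implicit Defensive.
Import Order.TTheory GRing.Theory Num.Theory.
Import numFieldNormedType.Exports.

Local Open Scope ring_scope.
Local Open Scope classical_set_scope.

Section Smoothness.
Variable R : realType.

Definition smooth_curve (V : normedModType R) (I : set R) (c : R -> V) : Prop :=
  forall (n : nat) (t : R), I t -> derivable (c^`(n)) t 1.

(* On an open set W of a finite-dimensional space this is F being of class C^k:
   a Frechet differentiable map all of whose directional derivatives are of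
   class C^(k-1) is of class C^k. *)
Fixpoint Ck_on (V W : normedModType R) (k : nat) (O : set V) (F : V -> W)
    : Prop :=
  if k is k'.+1 then
    (forall x, O x -> differentiable F x) /\
    (forall v : V, Ck_on k' O (fun x => 'D_v F x))
  else forall x, O x -> {for x, continuous F}.

Definition smooth_on (V W : normedModType R) (O : set V) (F : V -> W) : Prop :=
  forall k : nat, Ck_on k O F.

(* Smoothness of a map on an embedded submanifold M: F is locally the
   restriction of a smooth map of the ambient space. The values of F outside M
   are irrelevant. *)
Definition smooth_on_submanifold (V W : normedModType R) (M : set V)
    (F : V -> W) : Prop :=
  forall p, M p -> exists (O : set V) (G : V -> W),
    [/\ open O, O p, smooth_on O G & forall q, M q -> O q -> F q = G q].

Definition curve_through (V : normedModType R) (M : set V) (p v : V)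
    (c : R -> V) : Prop :=
  [/\ exists2 e : R, 0 < e & smooth_curve `]- e, e[ c /\
        (forall t, `]- e, e[%classic t -> M (c t)),
      c 0 = p & c^`() 0 = v].

Definition tangent_space (V : normedModType R) (M : set V) (p : V) : set V :=
  [set v | exists c, curve_through M p v c].

(* D is the derivative of F at p along the curves of M with velocity v. The
   first conjunct excludes the vacuous case where there is no such curve. *)
Definition is_dir_deriv (V W : normedModType R) (M : set V) (F : V -> W)
    (p v : V) (D : W) : Prop :=
  tangent_space M p v /\
  (forall c, curve_through M p v c -> is_derive (0 : R) 1 (F \o c) D).

(* D_X F at p; 0 is the default value when no derivative exists. *)
Definition dir_deriv (V W : normedModType R) (M : set V) (X : V -> V)
    (F : V -> W) (p : V) : W :=
  xget 0 [set D | is_dir_deriv M F p (X p) D].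

End Smoothness.

Section Riemannian.
Variables (R : realType) (l m : nat).
Implicit Types (M : set 'M[R]_(l, m)) (X Y : 'M[R]_(l, m) -> 'M[R]_(l, m)).

Definition frobenius (A B : 'M[R]_(l, m)) : R := \tr (A^T *m B).

(* 0 is the default value; on a linear subspace T the projection always exists
   and is unique. *)
Definition orth_proj (T : set 'M[R]_(l, m)) (A : 'M[R]_(l, m)) : 'M[R]_(l, m) :=
  xget 0 [set P | T P /\ forall B, T B -> frobenius (A - P) B = 0].

Definition smooth_tangent_field M X : Prop :=
  smooth_on_submanifold M X /\ (forall p, M p -> tangent_space M p (X p)).

Definition covariant_deriv M X Y (p : 'M[R]_(l, m)) : 'M[R]_(l, m) :=
  orth_proj (tangent_space M p) (dir_deriv M X Y p).

(* The velocity of c is a vector field along c only; its derivative in the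
   direction of c^`() t is the ordinary second derivative. *)
Definition geodesic M (I : set R) (c : R -> 'M[R]_(l, m)) : Prop :=
  [/\ smooth_curve I c, (forall t, I t -> M (c t)) &
      forall t, I t -> orth_proj (tangent_space M (c t)) ((c^`(2))%classic t) = 0].

End Riemannian.

Section FixedRank.
Variables (R : realType) (l m r : nat).

Definition fixed_rank : set 'M[R]_(l, m) := [set A | \rank A = r].

Definition factor_space : set ('M[R]_(l, r) * 'M[R]_(m, r)) :=
  [set p | p.1^T *m p.1 = 1%:M /\ \rank p.2 = r].

Definition horizontal (p : 'M[R]_(l, r) * 'M[R]_(m, r)) :
    set ('M[R]_(l, r) * 'M[R]_(m, r)) :=
  [set h | p.1^T *m h.1 = 0].

Definition horizontal_coords (p h : 'M[R]_(l, r) * 'M[R]_(m, r))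
    (A : 'M[R]_(l, m)) : Prop :=
  horizontal p h /\ A = h.1 *m p.2^T + p.1 *m h.2^T.

(* The components are functions of (U, Z), not of the matrix U *m Z^T: the
   factorization is only unique up to (U, Z) |-> (U *m P, Z *m P) with P
   orthogonal. They are determined by X on factor_space. *)
Definition horizontal_components (X : 'M[R]_(l, m) -> 'M[R]_(l, m))
    (XU : 'M[R]_(l, r) * 'M[R]_(m, r) -> 'M[R]_(l, r))
    (XZ : 'M[R]_(l, r) * 'M[R]_(m, r) -> 'M[R]_(m, r)) : Prop :=
  forall p, factor_space p ->
    horizontal_coords p (XU p, XZ p) (X (p.1 *m p.2^T)).

End FixedRank.

Arguments fixed_rank : clear implicits.
Arguments factor_space : clear implicits.

(* Main.v *)
(* Let T be the tangent space at U Z^T. It consists of the matrices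
   A Z^T + U B^T: horizontal (A, B) are velocities of explicit curves
   in the factor space (Cayley transform for U, straight line for Z), and
   conversely a curve c of rank r matrices satisfies
   c = c Z (U^T c Z)^-1 U^T c near 0, so that P c' Q = 0 for the projections
   P = 1 - U U^T and Q = 1 - Z (Z^T Z)^-1 Z^T.
   Along a curve of the factor space, the components of Y are rational
   expressions in U, Z and Y(U Z^T), hence differentiable, and
   D_X Y = D_X Y_U Z^T + Y_U X_Z^T + X_U Y_Z^T + U (D_X Y_Z)^T. Differentiating
   U^T Y_U = 0 shows that the stated coordinates are horizontal; the vector they
   represent differs from D_X Y by (X_U Y_Z^T + Y_U X_Z^T) Q, which is
   orthogonal to T. The geodesic equations are the same computation
   applied to the second derivative of U Z^T. *)

Require Import Defs.
From mathcomp Require Import all_boot all_order all_algebra.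
From mathcomp Require Import ring.
From mathcomp Require Import all_classical all_reals all_analysis.
Set Implicit Arguments.
Unset Strict Implicit.
Unset Printing Implicit Defensive.
Import Order.TTheory GRing.Theory Num.Theory.
Import numFieldNormedType.Exports.
Local Open Scope ring_scope.
Local Open Scope classical_set_scope.

(** * Derivatives of matrix-valued maps *)

Section MatrixDerive.
Variables (R : realType) (V : normedModType R).
Implicit Types (t v : V).

Lemma is_derive_mxP m n (M : V -> 'M[R]_(m, n)) t v D :
  is_derive t v M D <-> forall i j, is_derive t v (fun x => M x i j) (D i j).
Proof.
split=> [[dM <-] i j|dM].
  apply: DeriveDef; first by apply: (derivable_mxP M t v).1.
  by rewrite derive_mx // mxE.
have dM' : derivable M t v by apply/derivable_mxP => i j; have [] := dM i j.
apply: DeriveDef => //; rewrite derive_mx //; apply/matrixP => i j.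
by rewrite mxE; have [] := dM i j.
Qed.

Lemma is_derive_trmx m n (M : V -> 'M[R]_(m, n)) t v D :
  is_derive t v M D -> is_derive t v (fun x => (M x)^T) D^T.
Proof.
move=> /is_derive_mxP dM; apply/is_derive_mxP => i j; rewrite mxE.
by under eq_fun do rewrite mxE; exact: dM.
Qed.

Lemma is_derive_bigsum n (F : 'I_n -> V -> R) t v (D : 'I_n -> R) :
  (forall i, is_derive t v (F i) (D i)) ->
  is_derive t v (fun x => \sum_(i < n) F i x) (\sum_(i < n) D i).
Proof.
move=> dF; have -> : (fun x => \sum_(i < n) F i x) = \sum_(i < n) F i.
  by apply/funext => x; rewrite fct_sumE.
exact: is_derive_sum.
Qed.

Lemma is_derive_mulmx m n p (F : V -> 'M[R]_(m, n)) (G : V -> 'M[R]_(n, p))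
    t v dF dG :
  is_derive t v F dF -> is_derive t v G dG ->
  is_derive t v (fun x => F x *m G x) (dF *m G t + F t *m dG).
Proof.
move=> /is_derive_mxP hF /is_derive_mxP hG; apply/is_derive_mxP => i j.
under eq_fun do rewrite mxE.
rewrite !mxE -big_split /=; apply: is_derive_bigsum => k.
apply: (is_derive_eq (is_deriveM (hF i k) (hG k j))).
by rewrite addrC; congr (_ + _); rewrite [LHS]mulrC.
Qed.

Lemma derivable_bigsum (J : finType) (F : J -> V -> R) t v :
  (forall i, derivable (F i) t v) ->
  derivable (fun x => \sum_i F i x) t v.
Proof.
move=> dF; elim: (index_enum J) => [|i s IH].
  by under eq_fun do rewrite big_nil; exact: derivable_cst.
by under eq_fun do rewrite big_cons; exact: derivableD.
Qed.

Lemma derivable_bigprod (J : finType) (F : J -> V -> R) t v :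
  (forall i, derivable (F i) t v) ->
  derivable (fun x => \prod_i F i x) t v.
Proof.
move=> dF; elim: (index_enum J) => [|i s IH].
  by under eq_fun do rewrite big_nil; exact: derivable_cst.
by under eq_fun do rewrite big_cons; exact: derivableM.
Qed.

Lemma derivable_det n (M : V -> 'M[R]_n) t v :
  derivable M t v -> derivable (fun x => \det (M x)) t v.
Proof.
move=> /derivable_mxP dM; rewrite /determinant.
apply: derivable_bigsum => s; apply: derivableM; first exact: derivable_cst.
exact: derivable_bigprod.
Qed.

Lemma derivable_adjugate n (M : V -> 'M[R]_n) t v :
  derivable M t v -> derivable (fun x => \adj (M x)) t v.
Proof.
move=> /derivable_mxP dM; apply/derivable_mxP => i j.
under eq_fun do rewrite mxE /cofactor.
apply: derivableM; first exact: derivable_cst.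
apply: derivable_det; apply/derivable_mxP => a b.
by under eq_fun do rewrite !mxE; exact: dM.
Qed.

End MatrixDerive.

(** * Inverses, pairs and components along curves of a real variable *)

Section Curves.
Variable R : realType.

Lemma derivable_near_unitmx n (M : R -> 'M[R]_n) t :
  derivable M t 1 -> M t \in unitmx -> \near t, M t \in unitmx.
Proof.
move=> /derivable_det/derivable1_diffP/differentiable_continuous cM.
rewrite unitmxE unitfE => Mt.
have : \forall x \near t, \det (M x) != 0.
  exact: (cM _ (open_nbhs_nbhs (conj (@open_neq R 0) Mt))).
by apply: filterS => x; rewrite unitmxE unitfE.
Qed.

Lemma derivable_invmx n (M : R -> 'M[R]_n) t :
  derivable M t 1 -> M t \in unitmx -> derivable (fun x => invmx (M x)) t 1.
Proof.
move=> dM uM; have nM := derivable_near_unitmx dM uM.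
(* [invmx] leaves singular matrices unchanged, so the adjugate formula is available only near [t],
   where the determinant stays nonzero. *)
apply: (@near_eq_derivable _ _ _ (fun x => (\det (M x))^-1 *: \adj (M x))).
  by apply: filterS nM => /= x ux; rewrite /invmx ux.
have /derivable_mxP dA := derivable_adjugate dM.
apply/derivable_mxP => i j; under eq_fun do rewrite mxE.
apply: derivableM => //; apply: derivableV; last exact: derivable_det.
by rewrite -unitfE -unitmxE.
Qed.

(** Once the inverse is known to be derivable, its derivative is found by differentiating M M^-1 =
    1, an identity valid near [t], and solving for the unknown term. *)
Lemma is_derive_invmx n (M : R -> 'M[R]_n) (t : R) dM :
  is_derive t 1 M dM -> M t \in unitmx ->
  is_derive t 1 (fun x => invmx (M x)) (- (invmx (M t) *m dM *m invmx (M t))).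
Proof.
move=> hM uM; have [dM' _] := hM; have nM := derivable_near_unitmx dM' uM.
have /derivableP hI := derivable_invmx dM' uM.
apply: (is_derive_eq hI).
have h1 := is_derive_mulmx hM (derivableP (derivable_invmx dM' uM)).
have h2 : is_derive t 1 (fun x => M x *m invmx (M x)) (0 : 'M[R]_n).
  apply: (@near_eq_is_derive _ _ _ (cst 1%:M)).
  by apply: filterS nM => /= x ux; rewrite mulmxV.
have : dM *m invmx (M t) + M t *m 'D_1 (fun x => invmx (M x)) t = 0.
  by rewrite -(@derive_val _ _ _ _ _ _ _ h1) (@derive_val _ _ _ _ _ _ _ h2).
move=> /eqP; rewrite addrC addr_eq0 => /eqP /(congr1 (mulmx (invmx (M t)))).
by rewrite mulmxA mulVmx // mul1mx => ->; rewrite mulmxN mulmxA.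
Qed.

Lemma is_derive_comp_fst (V W : normedModType R) (c : R -> V * W) (t : R) d :
  is_derive t 1 c d -> is_derive t 1 (fun x => (c x).1) d.1.
Proof.
move=> [hc <-].
have hc1 : (h^-1 *: ((c \o shift t) (h *: 1) - c t)).1 @[h --> 0^'] -->
    ('D_1 c t).1.
  exact: (cvg_comp _ _ hc
    (@cvg_fst _ _ (nbhs ('D_1 c t).1) (nbhs ('D_1 c t).2) _)).
apply: DeriveDef; first by apply/cvg_ex; eexists; exact: hc1.
exact: cvg_lim hc1.
Qed.

Lemma is_derive_comp_snd (V W : normedModType R) (c : R -> V * W) (t : R) d :
  is_derive t 1 c d -> is_derive t 1 (fun x => (c x).2) d.2.
Proof.
move=> [hc <-].
have hc2 : (h^-1 *: ((c \o shift t) (h *: 1) - c t)).2 @[h --> 0^'] -->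
    ('D_1 c t).2.
  exact: (cvg_comp _ _ hc
    (@cvg_snd _ _ (nbhs ('D_1 c t).1) (nbhs ('D_1 c t).2) _)).
apply: DeriveDef; first by apply/cvg_ex; eexists; exact: hc2.
exact: cvg_lim hc2.
Qed.

Lemma is_derive_pair (V W : normedModType R) (f : R -> V) (g : R -> W)
    (t : R) df dg :
  is_derive t 1 f df -> is_derive t 1 g dg ->
  is_derive t 1 (fun x => (f x, g x)) (df, dg).
Proof.
move=> [hf <-] [hg <-].
apply: DeriveDef.
  by apply/derivable1_diffP/differentiable_pair; exact/derivable1_diffP.
rewrite deriveE; last first.
  by apply/differentiable_pair; exact/derivable1_diffP.
rewrite diff_pair; try exact/derivable1_diffP.
by rewrite !deriveE //; exact/derivable1_diffP.
Qed.

Lemma is_derive_mulmxlr m n p q (A : 'M[R]_(m, n)) (B : 'M[R]_(p, q))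
    (c : R -> 'M[R]_(n, p)) (t : R) d :
  is_derive t 1 c d -> is_derive t 1 (fun x => A *m c x *m B) (A *m d *m B).
Proof.
move=> dc; have := is_derive_mulmx (is_derive_mulmx (is_derive_cst A t 1) dc)
  (is_derive_cst B t 1).
by rewrite /= mul0mx add0r mulmx0 addr0.
Qed.

End Curves.

(** * Smooth curves *)

Section SmoothCurves.
Variable R : realType.
Implicit Types (I : set R) (t : R).

(** Smoothness cut at a finite order, so that closure properties go by induction: the derivative of
    a product, transpose or pair is built in the same way from maps with one order less to spare. *)
Definition derivable_upto (V : normedModType R) n I (f : R -> V) : Prop :=
  forall k t, (k < n)%N -> I t -> derivable (f^`(k)) t 1.

Lemma smooth_curveP (V : normedModType R) I (f : R -> V) :
  smooth_curve I f <-> forall n, derivable_upto n I f.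
Proof.
split=> [h n k t _|h n t It]; first exact: h.
exact: (h n.+1).
Qed.

Lemma derivable_upto0 (V : normedModType R) I (f : R -> V) :
  derivable_upto 0 I f.
Proof. by []. Qed.

Lemma derivable_uptoS (V : normedModType R) n I (f : R -> V) :
  derivable_upto n.+1 I f <->
  (forall t, I t -> derivable f t 1) /\ derivable_upto n I (f^`()).
Proof.
split=> [h|[h0 h] [|k] t kn It]; last 2 first.
- exact: h0.
- by rewrite derive1Sn; exact: h.
split=> [t It|k t kn It]; first exact: (h 0%N).
by rewrite -derive1Sn; exact: h.
Qed.

Lemma derivable_uptoW (V : normedModType R) n I (f : R -> V) :
  derivable_upto n.+1 I f -> derivable_upto n I f.
Proof. by move=> h k t kn; apply: h; exact: ltnW. Qed.

Lemma eq_open_near (V : normedModType R) I (f g : R -> V) t :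
  open I -> (forall x, I x -> f x = g x) -> I t -> \near t, f t = g t.
Proof.
move=> oI fg It; have : \forall x \near t, I x by exact: open_nbhs_nbhs.
by apply: filterS => x; exact: fg.
Qed.

Lemma derive1n_eq_open (V : normedModType R) I (f g : R -> V) k t :
  open I -> (forall x, I x -> f x = g x) -> I t -> f^`(k) t = g^`(k) t.
Proof.
move=> oI fg; elim: k t => [|k IH] t It; first exact: fg.
rewrite !derive1nS !derive1E; apply: near_eq_derive.
exact: (eq_open_near oI).
Qed.

Lemma derivable_upto_eq (V : normedModType R) n I (f g : R -> V) :
  open I -> (forall x, I x -> f x = g x) ->
  derivable_upto n I f -> derivable_upto n I g.
Proof.
move=> oI fg hf k t kn It; apply: near_eq_derivable (hf k t kn It).
apply: (eq_open_near oI) => // x Ix; exact: (derive1n_eq_open k oI).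
Qed.

Lemma derive1_val (V : normedModType R) (f : R -> V) t d :
  is_derive t 1 f d -> f^`() t = d.
Proof. by move=> h; rewrite derive1E derive_val. Qed.

Lemma derive1P (V : normedModType R) (f : R -> V) t :
  derivable f t 1 -> is_derive t 1 f (f^`() t).
Proof. by rewrite derive1E => /derivableP. Qed.

(** This is the induction step of all the closure lemmas. Since [I] is open, a formula for the
    derivative valid on [I] alone determines the higher derivatives there. *)
Lemma derivable_upto_deriv (V : normedModType R) n I (f g : R -> V) :
  open I -> (forall t, I t -> is_derive t 1 f (g t)) ->
  derivable_upto n I g -> derivable_upto n.+1 I f.
Proof.
move=> oI fg hg; apply/derivable_uptoS; split=> [t /fg[]//|].
by apply: derivable_upto_eq hg => // t It; rewrite (derive1_val (fg t It)).
Qed.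

Lemma derivable_upto_derive (V : normedModType R) n I (f : R -> V) t :
  derivable_upto n.+1 I f -> I t -> is_derive t 1 f (f^`() t).
Proof. by move=> /derivable_uptoS[h _] It; apply: derive1P; exact: h. Qed.

Lemma derivable_upto_cst (V : normedModType R) n I (a : V) :
  open I -> derivable_upto n I (cst a).
Proof.
move=> oI; elim: n a => [a|n IH a]; first exact: derivable_upto0.
exact: (derivable_upto_deriv (g := cst 0)).
Qed.

Lemma derivable_uptoD (V : normedModType R) n I (f g : R -> V) :
  open I -> derivable_upto n I f -> derivable_upto n I g ->
  derivable_upto n I (f + g).
Proof.
move=> oI; elim: n f g => [|n IH] f g hf hg; first exact: derivable_upto0.
have fg t (It : I t) : is_derive t 1 (f + g) ((derive1 f + derive1 g) t).
  by apply: is_deriveD; [exact: derivable_upto_derive hf It|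
    exact: derivable_upto_derive hg It].
apply: (derivable_upto_deriv oI fg).
by apply: IH; [have /derivable_uptoS[] := hf|have /derivable_uptoS[] := hg].
Qed.

Lemma derivable_upto_mulmx m n p k I (F : R -> 'M[R]_(m, n))
    (G : R -> 'M[R]_(n, p)) :
  open I -> derivable_upto k I F -> derivable_upto k I G ->
  derivable_upto k I (fun t => F t *m G t).
Proof.
move=> oI; elim: k F G => [|k IH] F G hF hG; first exact: derivable_upto0.
have FG t (It : I t) : is_derive t 1 (fun t => F t *m G t)
    (((fun t => derive1 F t *m G t) + (fun t => F t *m derive1 G t)) t).
  by apply: is_derive_mulmx;
    [exact: derivable_upto_derive hF It|exact: derivable_upto_derive hG It].
apply: (derivable_upto_deriv oI FG).
have [_ hF'] := (derivable_uptoS _ _ _).1 hF.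
have [_ hG'] := (derivable_uptoS _ _ _).1 hG.
exact: (derivable_uptoD oI (IH _ _ hF' (derivable_uptoW hG))
  (IH _ _ (derivable_uptoW hF) hG')).
Qed.

Lemma derivable_upto_trmx m n k I (F : R -> 'M[R]_(m, n)) :
  open I -> derivable_upto k I F -> derivable_upto k I (fun t => (F t)^T).
Proof.
move=> oI; elim: k F => [|k IH] F hF; first exact: derivable_upto0.
apply: (derivable_upto_deriv (g := fun t => (derive1 F t)^T)) => //.
  by move=> t It; apply: is_derive_trmx; exact: derivable_upto_derive hF It.
by apply: IH; have /derivable_uptoS[] := hF.
Qed.

Lemma derivable_upto_pair (V W : normedModType R) k I (f : R -> V)
    (g : R -> W) :
  open I -> derivable_upto k I f -> derivable_upto k I g ->
  derivable_upto k I (fun t => (f t, g t)).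
Proof.
move=> oI; elim: k f g => [|k IH] f g hf hg; first exact: derivable_upto0.
apply: (derivable_upto_deriv (g := fun t => (f^`() t, g^`() t))) => //.
  by move=> t It; apply: is_derive_pair; [exact: derivable_upto_derive hf It|
    exact: derivable_upto_derive hg It].
by apply: IH; [have /derivable_uptoS[] := hf|have /derivable_uptoS[] := hg].
Qed.

Lemma is_derive_affine (V : normedModType R) (a b : V) t :
  is_derive t 1 (fun x => a + x *: b) b.
Proof.
have h : differentiable (fun x : R => x *: b) t by exact: differentiableZl.
have db : is_derive t 1 (fun x : R => x *: b) b.
  apply: DeriveDef; first exact: diff_derivable.
  by rewrite deriveE // diffZl // diff_val /= scale1r.
by apply: (is_derive_eq (is_deriveD (is_derive_cst a t 1) db)); rewrite add0r.
Qed.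

Lemma derivable_upto_affine (V : normedModType R) k I (a b : V) :
  open I -> derivable_upto k I (fun x => a + x *: b).
Proof.
move=> oI; case: k => [|k]; first exact: derivable_upto0.
apply: (derivable_upto_deriv (g := cst b)) => // [t _|].
  exact: is_derive_affine.
exact: derivable_upto_cst.
Qed.

(* The resolvent satisfies f' = f W f, so each order of smoothness of f follows
   from the previous one. *)
Lemma derivable_upto_resolvent n k I (W : 'M[R]_n) :
  open I -> (forall t, 1%:M - t *: W \in unitmx) ->
  derivable_upto k I (fun t => invmx (1%:M - t *: W)).
Proof.
move=> oI uW; elim: k => [|k IH]; first exact: derivable_upto0.
have df t (It : I t) : is_derive t 1 (fun x => invmx (1%:M - x *: W))
    (invmx (1%:M - t *: W) *m W *m invmx (1%:M - t *: W)).
  have h : is_derive t 1 (fun x => 1%:M - x *: W) (- W).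
    by have := is_derive_affine 1%:M (- W) t;
      under eq_fun do rewrite scalerN.
  by apply: (is_derive_eq (is_derive_invmx h (uW t)));
    rewrite mulmxN mulNmx opprK.
have hW : derivable_upto k I (cst W) by exact: derivable_upto_cst.
apply: (derivable_upto_deriv oI df).
exact: (derivable_upto_mulmx oI (derivable_upto_mulmx oI IH hW) IH).
Qed.

End SmoothCurves.

(** * The tangent space of the fixed rank manifold *)

Section MatrixFacts.
Variable R : realType.

Lemma frobenius_eq0 m n (A : 'M[R]_(m, n)) : frobenius A A = 0 -> A = 0.
Proof.
rewrite /frobenius /mxtrace => /eqP.
have nneg (j : 'I_n) : true -> 0 <= (A^T *m A) j j.
  by move=> _; rewrite mxE sumr_ge0 // => i _; rewrite mxE -expr2 sqr_ge0.
rewrite psumr_eq0 // => /allP h; apply/matrixP => i j; rewrite mxE.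
have := h j (mem_index_enum j); rewrite mxE /= psumr_eq0; last first.
  by move=> k _; rewrite mxE -expr2 sqr_ge0.
by move=> /allP /(_ i (mem_index_enum i)) /=; rewrite mxE mulf_eq0 orbb => /eqP.
Qed.

Lemma mulmx_tr_eq0 m n (A : 'M[R]_(m, n)) : A *m A^T = 0 -> A = 0.
Proof.
move=> h; apply: trmx_inj; rewrite trmx0; apply: frobenius_eq0.
by rewrite /frobenius trmxK h mxtrace0.
Qed.

(** If v Z^T Z = 0 then (v Z^T)(v Z^T)^T = 0, so v Z^T = 0, and the rows of Z^T are independent. *)
Lemma gram_unitmx m r (Z : 'M[R]_(m, r)) : \rank Z = r -> Z^T *m Z \in unitmx.
Proof.
move=> rZ; rewrite -row_free_unit; apply: inj_row_free => v vZ.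
have fZ : row_free Z^T by rewrite /row_free mxrank_tr rZ.
have : v *m Z^T = 0.
  by apply: mulmx_tr_eq0; rewrite trmx_mul trmxK mulmxA -(mulmxA v) vZ mul0mx.
by rewrite -(mul0mx _ Z^T) => /(row_free_inj fZ).
Qed.

Lemma rank_unit_mull m r (A : 'M[R]_(r, m)) (B : 'M[R]_(m, r)) :
  A *m B \in unitmx -> \rank B = r.
Proof.
rewrite -row_full_unit => /eqP h; apply/eqP; rewrite eqn_leq rank_leq_col /=.
by rewrite -[leqLHS]h mxrankM_maxr.
Qed.

(** A row v in the kernel satisfies v = t v W, so v v^T = t v W v^T, and this 1 x 1 matrix is zero
    because W is skew. *)
Lemma skew_unitmx n (W : 'M[R]_n) t : W^T = - W -> 1%:M - t *: W \in unitmx.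
Proof.
move=> skW; rewrite -row_free_unit; apply: inj_row_free => v.
rewrite mulmxBr mulmx1 -scalemxAr => /eqP; rewrite subr_eq0 => /eqP vW.
apply: mulmx_tr_eq0; rewrite {1}vW -scalemxAl.
suff -> : v *m W *m v^T = 0 by rewrite scaler0.
have : (v *m W *m v^T)^T = - (v *m W *m v^T).
  by rewrite !trmx_mul trmxK skW mulNmx mulmxN mulmxA.
move=> /matrixP/(_ 0 0); rewrite mxE [in RHS]mxE => /eqP.
rewrite -addr_eq0 -mulr2n mulrn_eq0 /= => /eqP h.
by apply/matrixP => i j; rewrite !ord1 h mxE.
Qed.

Lemma rank_mul_factor l m r (p : 'M[R]_(l, r) * 'M[R]_(m, r)) :
  factor_space R l m r p -> \rank (p.1 *m p.2^T) = r.
Proof.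
case: p => U Z [/= UU rZ]; apply/eqP; rewrite eqn_leq.
rewrite (leq_trans (mxrankM_maxr _ _)) ?mxrank_tr ?rZ //=.
have e : U^T *m (U *m Z^T) = Z^T by rewrite mulmxA UU mul1mx.
by rewrite -[X in (X <= _)%N]rZ -mxrank_tr -{1}e mxrankM_maxr.
Qed.

(* With B = L M of inner dimension r, the matrix W B V = (W L)(M V) is a product
   of two invertible ones. *)
Lemma cross_decomposition l m r (B : 'M[R]_(l, m)) (W : 'M[R]_(r, l))
    (V : 'M[R]_(m, r)) :
  \rank B = r -> W *m B *m V \in unitmx ->
  B = B *m V *m invmx (W *m B *m V) *m (W *m B).
Proof.
move=> rB; move: (col_base B) (row_base B) (mulmx_base B).
rewrite rB => L M <-.
have -> : W *m (L *m M) *m V = (W *m L) *m (M *m V) by rewrite !mulmxA.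
set S1 := W *m L; set S2 := M *m V => uS.
have [uS1 uS2] : S1 \in unitmx /\ S2 \in unitmx.
  by apply/andP; rewrite -unitmx_mul.
have e : S2 *m invmx (S1 *m S2) = invmx S1.
  by rewrite -[LHS](mulKmx uS1) (mulmxA S1) mulmxV // mulmx1.
transitivity (L *m (S2 *m invmx (S1 *m S2) *m S1) *m M).
  by rewrite e mulVmx // mulmx1.
by rewrite /S1 /S2 !mulmxA.
Qed.

End MatrixFacts.

(** * Curves in the factor space, tangent vectors and projections *)

Section Tangent.
Variables (R : realType) (l m r : nat).
Local Notation point := ('M[R]_(l, r) * 'M[R]_(m, r))%type.

Lemma oppr_itvoo_mem0 (e : R) : 0 < e -> `]- e, e[%classic (0 : R).
Proof. by move=> e0; rewrite /= in_itv /= oppr_lt0 e0. Qed.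

(* The Cayley transform of the skew matrix (A U^T - U A^T) / 2 moves U with
   velocity A inside the matrices with orthonormal columns. *)
Lemma orthonormal_curve (U A : 'M[R]_(l, r)) :
  U^T *m U = 1%:M -> U^T *m A = 0 ->
  exists c : R -> 'M[R]_(l, r), [/\ smooth_curve setT c,
    forall t, (c t)^T *m c t = 1%:M, c 0 = U & is_derive (0 : R) 1 c A].
Proof.
move=> UU UA; pose W := 2^-1 *: (A *m U^T - U *m A^T) : 'M[R]_l.
have skW : W^T = - W.
  by rewrite /W linearZ /= linearB /= !trmx_mul !trmxK -scalerN opprB.
have uN t : 1%:M - t *: W \in unitmx by exact: skew_unitmx.
have uP t : 1%:M + t *: W \in unitmx.
  by have := uN (- t); rewrite scaleNr opprK.
have NPC t : (1%:M - t *: W) *m (1%:M + t *: W) =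
    (1%:M + t *: W) *m (1%:M - t *: W).
  rewrite mulmxBl mul1mx mulmxDr mulmx1 mulmxDl mul1mx mulmxBr mulmx1.
  by rewrite opprD !addrA addrK subrK.
exists (fun t => invmx (1%:M - t *: W) *m (1%:M + t *: W) *m U); split.
- apply/smooth_curveP => n; apply: (derivable_upto_mulmx openT).
    apply: (derivable_upto_mulmx openT).
      by apply: derivable_upto_resolvent; [exact: openT|exact: uN].
    by apply: derivable_upto_affine; exact: openT.
  by apply: derivable_upto_cst; exact: openT.
- move=> t; set N := 1%:M - t *: W; set P := 1%:M + t *: W.
  have trP : P^T = N by rewrite /P linearD /= linearZ /= skW trmx1 scalerN.
  have trN : N^T = P by rewrite -trP trmxK.
  rewrite !trmx_mul trmx_inv trP trN.
  (* With c = N^-1 P U and P^T = N, the product c^T c is U^T N P^-1 N^-1 P U; it collapses to U^T U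
     once N commutes with P^-1. *)
  have NP : N *m invmx P = invmx P *m N.
    by rewrite -[N in LHS](mulKmx (uP t)) -NPC -/N -/P mulmxA mulmxK ?uP.
  rewrite !mulmxA -(mulmxA _ N) NP mulmxA mulmxK ?uN //.
  by rewrite -(mulmxA U^T) mulVmx ?uP // mulmx1.
- by rewrite scale0r subr0 addr0 invmx1 !mul1mx.
have dN : is_derive (0 : R) 1 (fun x : R => 1%:M - x *: W) (- W).
  by have := is_derive_affine 1%:M (- W) 0; under eq_fun do rewrite scalerN.
have d1 := is_derive_invmx dN (uN 0).
have d2 := is_derive_mulmx (is_derive_mulmx d1 (is_derive_affine 1%:M W 0))
  (is_derive_cst U (0 : R) 1).
apply: (is_derive_eq d2).
rewrite !scale0r !subr0 !addr0 invmx1 !mul1mx !mulmx1 addr0 opprK /=.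
(* The derivative at 0 is 2 W U. The factor 1/2 in W makes this A, because U^T U = 1 and A^T U =
   0. *)
rewrite mulmxDl /W -scalemxAl mulmxBl -!mulmxA UU mulmx1.
have -> : A^T *m U = 0 by apply: trmx_inj; rewrite trmx_mul trmxK UA trmx0.
rewrite mulmx0 subr0 -scalerDl -mulr2n -[2^-1]mul1r -mulrnAl.
by rewrite divff ?pnatr_eq0 // scale1r.
Qed.

Lemma tangent_factor_space (p h : point) :
  factor_space R l m r p -> horizontal p h ->
  tangent_space (factor_space R l m r) p h.
Proof.
case: p => U Z; case: h => A B [/= UU rZ]; rewrite /horizontal /= => UA.
have [c [sc cc c0 dc]] := orthonormal_curve UU UA.
have dZ := is_derive_affine Z B 0.
(* Rank r persists along the line for small t: Z^T (Z + t B) is the Gram matrix at t = 0,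
   invertibility is an open condition, and it forces the second factor to have rank r. *)
have : \forall t \near (0 : R), Z^T *m (Z + t *: B) \in unitmx.
  apply: derivable_near_unitmx.
    have [] // := is_derive_mulmx (is_derive_cst Z^T (0 : R) 1) dZ.
  by rewrite scale0r addr0 gram_unitmx.
move=> /nbhs_ballP[e /= e0 he].
exists (fun t => (c t, Z + t *: B)); split.
- exists e => //; split.
    have oI : open (`]- e, e[%classic : set R) by exact: interval_open.
    apply/smooth_curveP => n; apply: (derivable_upto_pair oI).
      by move=> k t _ _; exact: sc.
    exact: derivable_upto_affine.
  move=> t te; split => //=; apply: (@rank_unit_mull _ _ _ Z^T); apply: he.
  rewrite /ball /= sub0r normrN; move: te; rewrite /= in_itv /=.
  by rewrite ltr_norml.
- by rewrite c0 scale0r addr0.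
- exact: derive1_val (is_derive_pair dc dZ).
Qed.

Lemma is_derive_curve_through (V : normedModType R) M (p v : V) c :
  curve_through M p v c -> is_derive (0 : R) 1 c v.
Proof.
move=> [[e e0 [sc _]] _ <-]; apply: derive1P.
by apply: (sc 0%N); exact: oppr_itvoo_mem0.
Qed.

Lemma near_curve_through (V : normedModType R) (M : set V) p v c :
  curve_through M p v c -> \forall t \near (0 : R), M (c t).
Proof.
move=> [[e e0 [_ Mc]] _ _].
have : \forall t \near (0 : R), `]- e, e[%classic t.
  by apply: open_nbhs_nbhs; split;
    [exact: interval_open|exact: oppr_itvoo_mem0].
by apply: filterS.
Qed.

Lemma smooth_curve_mul_tr I (F : R -> 'M[R]_(l, r)) (G : R -> 'M[R]_(m, r)) :
  open I -> smooth_curve I F -> smooth_curve I G ->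
  smooth_curve I (fun t => F t *m (G t)^T).
Proof.
move=> oI /smooth_curveP hF /smooth_curveP hG; apply/smooth_curveP => n.
by apply: (derivable_upto_mulmx oI) => //; apply: (derivable_upto_trmx oI).
Qed.

Lemma smooth_curve_fst (V W : normedModType R) I (c : R -> V * W) :
  open I -> smooth_curve I c -> smooth_curve I (fun t => (c t).1).
Proof.
move=> oI /smooth_curveP hc; apply/smooth_curveP => n; move: c {hc}(hc n).
elim: n => [|n IH] c hc; first exact: derivable_upto0.
apply: (derivable_upto_deriv (g := fun t => (derive1 c t).1)) => //.
  by move=> t It; apply: is_derive_comp_fst; exact: derivable_upto_derive hc It.
by apply: IH; have /derivable_uptoS[] := hc.
Qed.

Lemma smooth_curve_snd (V W : normedModType R) I (c : R -> V * W) :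
  open I -> smooth_curve I c -> smooth_curve I (fun t => (c t).2).
Proof.
move=> oI /smooth_curveP hc; apply/smooth_curveP => n; move: c {hc}(hc n).
elim: n => [|n IH] c hc; first exact: derivable_upto0.
apply: (derivable_upto_deriv (g := fun t => (derive1 c t).2)) => //.
  by move=> t It; apply: is_derive_comp_snd; exact: derivable_upto_derive hc It.
by apply: IH; have /derivable_uptoS[] := hc.
Qed.

Lemma curve_through_mul (p h : point) c :
  curve_through (factor_space R l m r) p h c ->
  curve_through (fixed_rank R l m r) (p.1 *m p.2^T)
    (h.1 *m p.2^T + p.1 *m h.2^T) (fun t => (c t).1 *m (c t).2^T).
Proof.
move=> hc; have dc := is_derive_curve_through hc.
have [[e e0 [sc Mc]] c0 _] := hc; split.
- exists e => //; split.
    have oI : open (`]- e, e[%classic : set R) by exact: interval_open.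
    apply: (smooth_curve_mul_tr oI); first exact: smooth_curve_fst.
    exact: smooth_curve_snd.
  by move=> t te; apply: rank_mul_factor; exact: Mc.
- by rewrite c0.
- have := derive1_val (is_derive_mulmx (is_derive_comp_fst dc)
    (is_derive_trmx (is_derive_comp_snd dc))).
  by rewrite c0.
Qed.

Lemma tangent_fixed_rank (p : point) v : factor_space R l m r p ->
  tangent_space (fixed_rank R l m r) (p.1 *m p.2^T) v <->
  exists h, horizontal_coords p h v.
Proof.
move=> fp; split; last first.
  move=> [h [hh ->]]; have [c hc] := tangent_factor_space fp hh.
  by eexists; exact: curve_through_mul hc.
case: p fp => U Z [/= UU rZ] [c hc].
have uG := gram_unitmx rZ; have dc := is_derive_curve_through hc.
have [_ c0 _] := hc.
pose P := 1%:M - U *m U^T; pose Q := 1%:M - Z *m invmx (Z^T *m Z) *m Z^T.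
have PU : P *m U = 0 by rewrite /P mulmxBl mul1mx -mulmxA UU mulmx1 subrr.
(* Near 0, P c Q is the product of P c Z, (U^T c Z)^-1 and U^T c Q. The two outer factors vanish at
   0, so every term of the product rule keeps a vanishing factor. *)
have PvQ : P *m v *m Q = 0.
  have dS := is_derive_mulmxlr U^T Z dc.
  have uS : U^T *m c 0 *m Z \in unitmx by rewrite c0 mulmxA UU mul1mx.
  have dF := is_derive_mulmx (is_derive_mulmxlr P Z dc) (is_derive_invmx dS uS).
  have := is_derive_mulmx dF (is_derive_mulmxlr U^T Q dc).
  have -> : U^T *m c 0 *m Q = 0.
    rewrite c0 mulmxA UU mul1mx /Q mulmxBr mulmx1 !mulmxA.
    by rewrite mulmxV // mul1mx subrr.
  have -> : P *m c 0 *m Z = 0 by rewrite c0 mulmxA PU !mul0mx.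
  rewrite mulmx0 !mul0mx addr0 => d0.
  have dPQ := is_derive_mulmxlr P Q dc.
  rewrite -(derive1_val dPQ); apply: derive1_val; apply: near_eq_is_derive d0.
  have [dS0 _] := dS; have nS := derivable_near_unitmx dS0 uS.
  have nM := near_curve_through hc.
  near=> t; have rt : \rank (c t) = r by near: t.
  have ut : U^T *m c t *m Z \in unitmx by near: t.
  by rewrite [in RHS](cross_decomposition rt ut) !mulmxA.
(* Split v as U U^T v + P v. The first summand gives B = v^T U; since P v Q = 0, the second equals P
   v Z (Z^T Z)^-1 Z^T, which gives A. *)
exists ((v - U *m U^T *m v) *m Z *m invmx (Z^T *m Z), v^T *m U); split => /=.
  rewrite /horizontal /= !mulmxA mulmxBr !mulmxA UU mul1mx subrr.
  by rewrite !mul0mx.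
move: PvQ; rewrite /P /Q mulmxBl mul1mx mulmxBr mulmx1 => /eqP.
rewrite subr_eq0 => /eqP /esym.
by rewrite !mulmxA trmx_mul trmxK mulmxA => ->; rewrite subrK.
Unshelve. all: by end_near. Qed.

Lemma horizontal_coordsB (p h k : point) A B :
  horizontal_coords p h A -> horizontal_coords p k B ->
  horizontal_coords p (h - k) (A - B).
Proof.
move=> [h0 ->] [k0 ->]; split.
  by rewrite /horizontal /= mulmxBr h0 k0 subrr.
by rewrite /= mulmxBl linearB /= mulmxBr opprD addrACA.
Qed.

(** Uniqueness of horizontal coordinates: multiplying by U^T on the left isolates B^T, and then
    multiplying by Z (Z^T Z)^-1 on the right recovers A. *)
Lemma horizontal_coords_eq0 (p h : point) :
  factor_space R l m r p -> horizontal_coords p h 0 -> h.1 = 0 /\ h.2 = 0.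
Proof.
case: p h => U Z [A B] [/= UU rZ] [/=]; rewrite /horizontal /= => UA e.
have B0 : B = 0.
  apply: trmx_inj; rewrite trmx0 -[LHS]mul1mx -UU -mulmxA.
  have := congr1 (mulmx U^T) e; rewrite mulmx0 mulmxDr mulmxA UA mul0mx add0r.
  by move<-.
split => //; move: e; rewrite B0 trmx0 mulmx0 addr0 => /(congr1 (mulmx^~ Z)).
rewrite mul0mx -mulmxA => /(congr1 (mulmx^~ (invmx (Z^T *m Z)))).
by rewrite mul0mx mulmxK ?gram_unitmx.
Qed.

(** The difference of two candidate projections lies in T and is orthogonal to itself, so the choice
    made by [orth_proj] is forced. *)
Lemma orth_proj_eq (T : set 'M[R]_(l, m)) A P :
  (forall B C, T B -> T C -> T (B - C)) -> T P ->
  (forall B, T B -> frobenius (A - P) B = 0) -> orth_proj T A = P.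
Proof.
move=> TB TP orthP; apply: xget_unique => //= Q [TQ orthQ].
apply/eqP; rewrite -subr_eq0; apply/eqP/frobenius_eq0.
have TPQ := TB _ _ TQ TP.
have -> : frobenius (Q - P) (Q - P) =
    frobenius (A - P) (Q - P) - frobenius (A - Q) (Q - P).
  rewrite /frobenius -linearB /= -mulmxBl -linearB /=.
  by have -> : A - P - (A - Q) = Q - P by rewrite opprB addrC addrA subrK.
by rewrite orthP // orthQ // subrr.
Qed.

(* The formula shared by both parts: XU = YU = U', XZ = YZ = Z' gives the
   acceleration of a curve. *)
Lemma orth_proj_second_order (U XU YU DU : 'M[R]_(l, r))
    (Z XZ YZ DZ : 'M[R]_(m, r)) :
  factor_space R l m r (U, Z) -> U^T *m XU = 0 -> U^T *m YU = 0 ->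
  XU^T *m YU + U^T *m DU = 0 ->
  horizontal_coords (U, Z)
    (DU + U *m XU^T *m YU + (XU *m YZ^T + YU *m XZ^T) *m Z *m invmx (Z^T *m Z),
     DZ - Z *m YU^T *m XU)
    (orth_proj (tangent_space (fixed_rank R l m r) (U *m Z^T))
      (DU *m Z^T + YU *m XZ^T + (XU *m YZ^T + U *m DZ^T))).
Proof.
move=> fUZ UX UY UD; have [/= UU rZ] := fUZ; have uG := gram_unitmx rZ.
set E := XU *m YZ^T + YU *m XZ^T; set G := invmx (Z^T *m Z).
have UE : U^T *m E = 0 by rewrite mulmxDr !mulmxA UX UY !mul0mx addr0.
set h := (X in horizontal_coords _ X _).
(* U^T E = 0 removes the last term of the first coordinate; the other two give U^T DU + XU^T YU,
   which is zero by the differentiated constraint. *)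
have hh : horizontal (U, Z) h.
  rewrite /horizontal /= !mulmxDr !mulmxA UU mul1mx UE !mul0mx addr0.
  by rewrite addrC.
suff -> : orth_proj (tangent_space (fixed_rank R l m r) (U *m Z^T))
      (DU *m Z^T + YU *m XZ^T + (XU *m YZ^T + U *m DZ^T)) =
    h.1 *m Z^T + U *m h.2^T by split.
have tE v := tangent_fixed_rank v fUZ; rewrite /= in tE.
apply: orth_proj_eq.
- move=> B C /tE[b hb] /tE[c hc]; apply/tE.
  by exists (b - c); exact: horizontal_coordsB.
- by apply/tE; exists h.
move=> B /tE[b [hb ->]] /=.
set A := (X in frobenius X _).
(* The contributions U XU^T YU Z^T of the two coordinates have opposite signs and cancel, and so do
   those of DU and DZ; only E minus E Z G Z^T is left. *)
have -> : A = E *m (1%:M - Z *m G *m Z^T).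
  rewrite /A /h /= linearB /= !trmx_mul !trmxK !mulmxBr mulmx1.
  rewrite 2!mulmxDl !mulmxA [in RHS]/E; set E' := E *m _ *m _ *m _.
  set K := U *m _ *m _ *m _.
  move: (DU *m _) (YU *m _) (XU *m _) (U *m DZ^T) E' K => a y x d e k.
  by apply/matrixP => i j; rewrite !mxE; ring.
rewrite /frobenius mulmxDr linearD /= trmx_mul.
(* Write Q for 1 - Z G Z^T. The residual E Q is orthogonal to U b.2^T because U^T E = 0, and to b.1
   Z^T because Q Z = 0. *)
have -> : (1%:M - Z *m G *m Z^T)^T *m E^T *m (U *m b.2^T) = 0.
  rewrite -mulmxA (mulmxA _ U) -[E^T *m U]trmxK trmx_mul trmxK UE trmx0.
  by rewrite mul0mx mulmx0.
have QZ : (1%:M - Z *m G *m Z^T) *m Z = 0.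
  by rewrite mulmxBl mul1mx -!mulmxA mulVmx // mulmx1 subrr.
rewrite mxtrace0 addr0 mulmxA mxtrace_mulC !mulmxA -trmx_mul QZ.
by rewrite trmx0 !mul0mx mxtrace0.
Qed.

End Tangent.

(** * Covariant derivative and geodesics *)

Section FieldDerivative.
Variable R : realType.

(* Near p the field agrees on M with a map that is differentiable at p, hence
   its derivative along a curve of M depends on the velocity only. *)
Lemma smooth_on_submanifold_is_derive (V W : normedModType R) (M : set V)
    (F : V -> W) p : smooth_on_submanifold M F -> M p ->
  exists L : V -> W, forall v (c : R -> V), is_derive (0 : R) 1 c v ->
    c 0 = p -> (\forall t \near (0 : R), M (c t)) ->
    is_derive (0 : R) 1 (F \o c) (L v).
Proof.
move=> sF Mp; have [N [G [oO Op sG FG]]] := sF p Mp.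
have [dG _] := sG 1%N; have {}dG := dG p Op.
exists ('d G p) => v c dc c0 Mc; have [dc0 vE] := dc.
have dc1 : differentiable c (0 : R) by exact/derivable1_diffP.
have nO : \forall t \near (0 : R), N (c t).
  have := differentiable_continuous dc1.
  by apply; apply: open_nbhs_nbhs; rewrite c0.
have dG0 : differentiable G (c 0) by rewrite c0.
apply: (@near_eq_is_derive _ _ _ (G \o c)).
  by near=> t; apply/esym/FG; near: t.
have dGc : differentiable (G \o c) (0 : R) by exact: differentiable_comp.
apply: DeriveDef; first exact: diff_derivable.
by rewrite deriveE // diff_comp //= c0 -vE deriveE.
Unshelve. all: by end_near. Qed.

(** The tangency conjunct of [is_dir_deriv] supplies a curve, and the derivative along that single
    curve already fixes the value. *)
Lemma dir_derivE (V W : normedModType R) (M : set V) (X : V -> V)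
    (F : V -> W) p D :
  is_dir_deriv M F p (X p) D -> dir_deriv M X F p = D.
Proof.
move=> hD; apply: xget_unique => //= D' [[c hc] hD'].
have [_ hD0] := hD.
by have := derive1_val (hD' c hc); rewrite (derive1_val (hD0 c hc)).
Qed.

End FieldDerivative.

(** * Horizontal coordinates of the covariant derivative and of the acceleration *)

Section Main.
Variables (R : realType) (l m r : nat).
Local Notation point := ('M[R]_(l, r) * 'M[R]_(m, r))%type.

(** No smoothness of [YU] and [YZ] is assumed: their differentiability along curves of the factor
    space is deduced from that of [Y]. *)
Lemma covariant_deriv_coords (X Y : 'M[R]_(l, m) -> 'M[R]_(l, m))
    (XU YU : point -> 'M[R]_(l, r)) (XZ YZ : point -> 'M[R]_(m, r)) U Z :
  smooth_tangent_field (fixed_rank R l m r) Y ->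
  horizontal_components X XU XZ -> horizontal_components Y YU YZ ->
  factor_space R l m r (U, Z) ->
  let p := (U, Z) in
  let XH := fun q => (XU q, XZ q) in
  let DYU := dir_deriv (factor_space R l m r) XH YU p in
  let DYZ := dir_deriv (factor_space R l m r) XH YZ p in
  horizontal_coords p
    (DYU + U *m (XU p)^T *m YU p
       + (XU p *m (YZ p)^T + YU p *m (XZ p)^T) *m Z *m invmx (Z^T *m Z),
     DYZ - Z *m (YU p)^T *m XU p)
    (covariant_deriv (fixed_rank R l m r) X Y (U *m Z^T)).
Proof.
move=> [sY _] hX hY fp p XH DYU DYZ.
have [/= UU rZ] := fp; have uG := gram_unitmx rZ.
have [UX XE] := hX p fp; rewrite /horizontal /= in UX XE.
have [UY _] := hY p fp; rewrite /horizontal /= in UY.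
have Mp : fixed_rank R l m r (U *m Z^T) by exact: rank_mul_factor fp.
have [L hL] := smooth_on_submanifold_is_derive sY Mp.
set G := invmx (Z^T *m Z).
(* [DZ] comes from differentiating YZ = Y^T U, and [DU] from solving the product rule for Y = YU Z^T
   + U YZ^T by right multiplication with Z G. Neither mentions a curve, as the definition of
   [dir_deriv] demands. *)
pose DZ : 'M[R]_(m, r) := (L (X (U *m Z^T)))^T *m U + (Y (U *m Z^T))^T *m XU p.
pose DU : 'M[R]_(l, r) := (L (X (U *m Z^T)) - YU p *m (XZ p)^T
  - (XU p *m (YZ p)^T + U *m DZ^T)) *m Z *m G.
have along c : curve_through (factor_space R l m r) p (XH p) c ->
  [/\ is_derive (0 : R) 1 (YU \o c) DU, is_derive (0 : R) 1 (YZ \o c) DZ,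
   (XU p)^T *m YU p + U^T *m DU = 0 &
   L (X (U *m Z^T)) = DU *m Z^T + YU p *m (XZ p)^T
     + (XU p *m (YZ p)^T + U *m DZ^T)].
  move=> hc; have hMc := curve_through_mul hc.
  have dc := is_derive_curve_through hc; have [_ c0 _] := hc.
  have fc := near_curve_through hc.
  have dU := is_derive_comp_fst dc; have dZ := is_derive_comp_snd dc.
  have c10 : (c 0).1 = U by rewrite c0.
  have c20 : (c 0).2 = Z by rewrite c0.
  rewrite /= in dU dZ.
  have [_ e0 _] := hMc; rewrite /= in e0.
  have dY := hL _ _ (is_derive_curve_through hMc) e0 (near_curve_through hMc).
  rewrite /= -XE in dY.
  have UYc : \forall t \near (0 : R), (c t).1^T *m YU (c t) = 0.
    by apply: filterS fc => t /hY[].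
  have YZc : \forall t \near (0 : R),
      (Y ((c t).1 *m (c t).2^T))^T *m (c t).1 = YZ (c t).
    near=> t; have ft : factor_space R l m r (c t) by near: t.
    have [/= h ->] := hY _ ft; have [UUt _] := ft.
    rewrite linearD /= !trmx_mul !trmxK mulmxDl -!mulmxA UUt mulmx1.
    by rewrite -[(YU _)^T *m _]trmxK trmx_mul trmxK h trmx0 mulmx0 add0r.
  have YUc : \forall t \near (0 : R),
      (Y ((c t).1 *m (c t).2^T) - (c t).1 *m (YZ (c t))^T) *m (c t).2
        *m invmx ((c t).2^T *m (c t).2) = YU (c t).
    near=> t; have ft : factor_space R l m r (c t) by near: t.
    have [/= h ->] := hY _ ft; have [_ rZt] := ft.
    by rewrite addrK -(mulmxA (YU _)) mulmxK // gram_unitmx.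
  have dYZ : is_derive (0 : R) 1 (YZ \o c) DZ.
    apply: near_eq_is_derive YZc _.
    have := is_derive_mulmx (is_derive_trmx dY) dU.
    by rewrite /= c10 c20.
  (* The rational expression [YUc] serves only to show that the derivative exists; its value is read
     off below from the product rule, which avoids differentiating the inverse Gram matrix
     explicitly. *)
  have dYU0 : derivable (YU \o c) (0 : R) 1.
    apply: near_eq_derivable YUc _.
    have uG0 : (c 0).2^T *m (c 0).2 \in unitmx by rewrite c20.
    have dI := is_derive_invmx (is_derive_mulmx (is_derive_trmx dZ) dZ) uG0.
    have dD := is_deriveB dY (is_derive_mulmx dU (is_derive_trmx dYZ)).
    by have [] := is_derive_mulmx (is_derive_mulmx dD dZ) dI.
  have dYU := derivableP dYU0; set DU' := 'D_1 (YU \o c) 0 in dYU.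
  have LE : L (X (U *m Z^T)) = DU' *m Z^T + YU p *m (XZ p)^T
      + (XU p *m (YZ p)^T + U *m DZ^T).
    rewrite -(derive1_val dY); apply: derive1_val.
    have dS := is_deriveD (is_derive_mulmx dYU (is_derive_trmx dZ))
      (is_derive_mulmx dU (is_derive_trmx dYZ)).
    rewrite /= c0 in dS; apply: near_eq_is_derive dS.
    by apply: filterS fc => t /hY[_ /= ->].
  have DUE : DU' = DU.
    by rewrite /DU LE addrAC !addrK -(mulmxA DU') mulmxK.
  rewrite -DUE; split => //.
  (* U^T YU vanishes along the curve, so its derivative XU^T YU + U^T DU is zero. *)
  have d0 := is_derive_mulmx (is_derive_trmx dU) dYU.
  rewrite /= c0 in d0; rewrite -(derive1_val d0); apply: derive1_val.
  apply: (@near_eq_is_derive _ _ _ (cst 0)).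
  by apply: filterS UYc => t ->.
have tp : tangent_space (factor_space R l m r) p (XH p).
  exact: tangent_factor_space.
(* The last two facts in [along] do not involve the curve, so one curve with velocity [XH p] is
   enough to obtain them. *)
have [c hc] := tp; have [_ _ UD LE] := along c hc.
have -> : DYU = DU by apply: dir_derivE; split => // c' /along[].
have -> : DYZ = DZ by apply: dir_derivE; split => // c' /along[].
have -> : covariant_deriv (fixed_rank R l m r) X Y (U *m Z^T) =
    orth_proj (tangent_space (fixed_rank R l m r) (U *m Z^T))
      (L (X (U *m Z^T))).
  rewrite /covariant_deriv; congr orth_proj; apply: dir_derivE; split.
    by apply/(tangent_fixed_rank _ fp); exists (XH p).
  move=> c' hc'; have [_ c'0 _] := hc'.
  exact: (hL _ _ (is_derive_curve_through hc') c'0 (near_curve_through hc')).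
by rewrite LE; exact: orth_proj_second_order.
Unshelve. all: by end_near. Qed.

(** The left-hand sides are the horizontal coordinates of the projected acceleration. Uniqueness of
    coordinates turns a zero projection into the equations; conversely, zero coordinates represent
    the zero vector. *)
Lemma geodesic_equations (I : set R) (U : R -> 'M[R]_(l, r))
    (Z : R -> 'M[R]_(m, r)) :
  open I -> smooth_curve I U -> smooth_curve I Z ->
  (forall t, I t -> factor_space R l m r (U t, Z t)) ->
  (forall t, I t -> horizontal (U t, Z t) (U^`() t, Z^`() t)) ->
  let dU := (U^`())%classic in let ddU := (U^`(2))%classic in
  let dZ := (Z^`())%classic in let ddZ := (Z^`(2))%classic in
  (geodesic (fixed_rank R l m r) I (fun t => U t *m (Z t)^T) <->
   forall t, I t ->
     ddU t + U t *m (dU t)^T *m dU t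
       + 2 *: (dU t *m (dZ t)^T *m Z t *m invmx ((Z t)^T *m Z t)) = 0
     /\ ddZ t - Z t *m (dU t)^T *m dU t = 0).
Proof.
move=> oI sU sZ fUZ hUZ dU ddU dZ ddZ.
have hU t : I t -> is_derive t 1 U (dU t).
  by move=> It; apply: derive1P; exact: (sU 0%N).
have hZ t : I t -> is_derive t 1 Z (dZ t).
  by move=> It; apply: derive1P; exact: (sZ 0%N).
have hdU t : I t -> is_derive t 1 dU (ddU t).
  by move=> It; apply: derive1P; exact: (sU 1%N).
have hdZ t : I t -> is_derive t 1 dZ (ddZ t).
  by move=> It; apply: derive1P; exact: (sZ 1%N).
pose c t := U t *m (Z t)^T.
have c2 t : I t -> (c^`(2))%classic t =
    ddU t *m (Z t)^T + dU t *m (dZ t)^T + (dU t *m (dZ t)^T + U t *m (ddZ t)^T).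
  move=> It; pose c1 t := dU t *m (Z t)^T + U t *m (dZ t)^T.
  have -> : (c^`(2))%classic t = c1^`() t.
    rewrite derive1Sn derive1n1 !derive1E; apply: near_eq_derive.
    apply: (eq_open_near oI) => // x Ix; apply: derive1_val.
    by apply: is_derive_mulmx; [exact: hU|apply: is_derive_trmx; exact: hZ].
  apply: derive1_val; apply: is_deriveD.
    apply: is_derive_mulmx; [exact: hdU|apply: is_derive_trmx; exact: hZ].
  by apply: is_derive_mulmx; [exact: hU|apply: is_derive_trmx; exact: hdZ].
(* Derivative of the horizontality condition U^T U' = 0, which holds on the open set [I]. *)
have UdU t : I t -> (dU t)^T *m dU t + (U t)^T *m ddU t = 0.
  move=> It; have d0 := is_derive_mulmx (is_derive_trmx (hU t It)) (hdU t It).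
  rewrite -(derive1_val d0); apply: derive1_val.
  apply: (@near_eq_is_derive _ _ _ (cst 0)).
  by apply: (eq_open_near oI) => // x Ix; rewrite [RHS](hUZ x Ix).
have accel t (It : I t) := orth_proj_second_order (dZ t) (dZ t) (ddZ t)
  (fUZ t It) (hUZ t It) (hUZ t It) (UdU t It).
(* The factor 2 arises because the two summands of E coincide when both fields are the velocity. *)
have eqE t : ddU t + U t *m (dU t)^T *m dU t
       + 2 *: (dU t *m (dZ t)^T *m Z t *m invmx ((Z t)^T *m Z t)) =
    ddU t + U t *m (dU t)^T *m dU t
       + (dU t *m (dZ t)^T + dU t *m (dZ t)^T) *m Z t *m invmx ((Z t)^T *m Z t).
  by rewrite scaler_nat mulr2n !mulmxDl.
split.
  move=> [_ _ geo] t It; rewrite eqE.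
  have := accel t It; rewrite -c2 // geo //.
  by move=> /(horizontal_coords_eq0 (fUZ t It))[].
move=> eqs; split.
- exact: smooth_curve_mul_tr.
- by move=> t It; have := rank_mul_factor (fUZ t It).
move=> t It; have := accel t It; rewrite -c2 // => -[_ ->].
have [e1 e2] := eqs t It; rewrite eqE in e1.
by rewrite /= e1 e2 mul0mx trmx0 mulmx0 addr0.
Qed.

End Main.

Theorem theorem2p12 (R : realType) (l m r : nat) :
  (forall (X Y : 'M[R]_(l, m) -> 'M[R]_(l, m))
      (XU YU : 'M[R]_(l, r) * 'M[R]_(m, r) -> 'M[R]_(l, r))
      (XZ YZ : 'M[R]_(l, r) * 'M[R]_(m, r) -> 'M[R]_(m, r)),
    smooth_tangent_field (fixed_rank R l m r) X ->
    smooth_tangent_field (fixed_rank R l m r) Y ->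
    horizontal_components X XU XZ ->
    horizontal_components Y YU YZ ->
    forall (U : 'M[R]_(l, r)) (Z : 'M[R]_(m, r)),
      factor_space R l m r (U, Z) ->
      let p := (U, Z) in
      let XH := fun q => (XU q, XZ q) in
      let DYU := dir_deriv (factor_space R l m r) XH YU p in
      let DYZ := dir_deriv (factor_space R l m r) XH YZ p in
      horizontal_coords p
        (DYU + U *m (XU p)^T *m YU p
           + (XU p *m (YZ p)^T + YU p *m (XZ p)^T) *m Z *m invmx (Z^T *m Z),
         DYZ - Z *m (YU p)^T *m XU p)
        (covariant_deriv (fixed_rank R l m r) X Y (U *m Z^T)))
  /\
  (forall (I : set R) (U : R -> 'M[R]_(l, r)) (Z : R -> 'M[R]_(m, r)),
    open I -> is_interval I ->
    smooth_curve I U -> smooth_curve I Z ->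
    (forall t, I t -> factor_space R l m r (U t, Z t)) ->
    (forall t, I t -> horizontal (U t, Z t) (U^`() t, Z^`() t)) ->
    let dU := (U^`())%classic in let ddU := (U^`(2))%classic in
    let dZ := (Z^`())%classic in let ddZ := (Z^`(2))%classic in
    (geodesic (fixed_rank R l m r) I (fun t => U t *m (Z t)^T) <->
     forall t, I t ->
       ddU t + U t *m (dU t)^T *m dU t
         + 2 *: (dU t *m (dZ t)^T *m Z t *m invmx ((Z t)^T *m Z t)) = 0
       /\ ddZ t - Z t *m (dU t)^T *m dU t = 0)).
Proof.
split=> [X Y XU YU XZ YZ _ sY hX hY U Z fp|I U Z oI _ sU sZ fUZ hUZ].
  exact: covariant_deriv_coords.
exact: geodesic_equations.
Qed.
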